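(* Let $k\ge1$ and let $\{(X_n,x_n,T_n)\}_n\subset\mathcal{M}^k_*$ be a sequence of $k$-dimensional pointed locally integral current spaces. Assume that there exist $(Z,z,T)\in\mathcal{M}^k_*$ and isometric embeddings $\phi_n:X_n\hookrightarrow Z$ such that $\phi_n(x_n)\to z$ as $n\to\infty$ and $\phi_{n\#}T_n$ converges to $T$ in the local flat topology. Then $$d_{\mathcal{F}*}\big((X_n,x_n,T_n),(Z,z,T)\big)\to0\quad (n\to\infty).$$
   Context: Metric spaces are nonempty; isometric embeddings are distance-preserving maps (not necessarily surjective). Let $X$ be a complete metric space. $B_r(A)$, $\bar B_r(A)$ denote the open and closed $r$-neighborhoods of a point or set $A$; $\operatorname{spt} f:=\overline{\{f\ne0\}}$. Function classes: $\mathrm{Lip}_{\mathrm{Loc}}(X)$ = functions $X\to\mathbb{R}$ that are Lipschitz on every bounded set; $\mathrm{Lip}_1(X)$ = 1-Lipschitz functions $X\to\mathbb{R}$; $\mathrm{Lip}_{\mathrm B}(X)$ = bounded Lipschitz functions $X\to\mathbb R$ with bounded support. $\mathcal{D}^k(X):=\mathrm{Lip}_{\mathrm B}(X)\times(\mathrm{Lip}_{\mathrm{Loc}}(X))^k$, with elements written $(f,\pi)=(f,\pi_1,\dots,\pi_k)$. Metric functional: a $k$-dimensional metric functional on $X$ ($k\ge0$) is a function $T:\mathcal{D}^k(X)\to\mathbb{R}$ that is (i) multilinear; (ii) continuous: $T(f,\pi^j)\to T(f,\pi)$ whenever $\pi_i^j\to\pi_i$ pointwise for each $i$ with $\sup_j\mathrm{Lip}(\pi_i^j|_B)<\infty$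 for each $i$ and each bounded $B\subset X$; (iii) local: $T(f,\pi)=0$ if some $\pi_i$ is constant on $\bar B_\delta(\operatorname{spt} f)$ for some $\delta>0$. Boundary ($k\ge1$): $(\partial T)(f,\pi_1,\dots,\pi_{k-1}):=T(\sigma,f,\pi_1,\dots,\pi_{k-1})$ for any $\sigma\in\mathrm{Lip}_{\mathrm B}(X)$ with $\sigma=1$ on $\bar B_\delta(\operatorname{spt} f)$ for some $\delta>0$ (independent of $\sigma$ by locality); it is a $(k-1)$-dimensional metric functional. Pushforward: if $\phi:X\to X'$ is Lipschitz on bounded sets and preimages of bounded sets are bounded, $(\phi_\#T)(f,\pi):=T(f\circ\phi,\pi_1\circ\phi,\dots,\pi_k\circ\phi)$. Mass: for open $O$, $\|T\|(O):=\sup\sum_{j=1}^N T(f^j,\pi^j)$ over all $N$ and $(f^j,\pi^j)\in\mathrm{Lip}_{\mathrm B}(X)\times(\mathrm{Lip}_1(X))^k$ with $\operatorname{spt} f^j\subset O$, $\sum_j|f^j|\le1$; for any $A\subset X$, $\|T\|(A):=\inf\{\|T\|(O):O\supset A\text{ open}\}$. $\mathbf{M}_{\mathrm{Loc},k}(X)$: the $k$-dimensional metric functionals $T$ such that for every bounded open $O$: $\|T\|(O)<\infty$, and for every $\epsilon>0$ there is a compact $K\subset O$ with $\|T\|(O\setminus K)<\epsilon$. Then $\|T\|$ is an outer measure for which Borel sets are measurable, and $T$ extends to $(f,\pi)$ with $f$ bounded Borel of bounded support by $T(f,\pi):=\lim_n T(f_n,\pi)$, where $f_n\in\mathrm{Lip}_{\mathrm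 B}(X)$ have supports in a fixed bounded neighborhood of $\operatorname{spt} f$ and $f_n\to f$ in $L^1(\|T\|)$ (the limit exists and is independent of choices). For a Borel set $A$, $(T\llcorner A)(f,\pi):=T(f\chi_A,\pi)$. Locally integer rectifiable currents: a compact $k$-rectifiable set is a finite union of images of compact subsets of $\mathbb{R}^k$ under Lipschitz maps into $X$. $\mathcal{I}_{\mathrm{Loc},k}(X)$ is the set of $T\in\mathbf{M}_{\mathrm{Loc},k}(X)$ such that (i) for every bounded open $O$ and $\epsilon>0$ there is a compact $k$-rectifiable set $K$ with $\|T\|(O\setminus K)<\epsilon$; (ii) for every bounded Borel $B\subset X$ and Lipschitz $\pi:X\to\mathbb{R}^k$ there is $\theta\in L^1(\mathbb{R}^k,\mathbb{Z})$ with $\pi_\#(T\llcorner B)=[\theta]$, where $(\pi_\#(T\llcorner B))(f,\tau):=T(\chi_B\,(f\circ\pi),\tau\circ\pi)$ and $[\theta](f,\tau_1,\dots,\tau_k):=\int_{\mathbb{R}^k}f\,\theta\,\det(\nabla\tau)\,d\mathcal{L}^k$ (for $k=0$, $\mathbb{R}^0$ is a point with counting measure). For $k\ge1$, the set of locally integral currents is $\mathbf{I}_{\mathrm{Loc},k}(X):=\{T\in\mathcal{I}_{\mathrm{Loc},k}(X):\partial T\in\mathcal{I}_{\mathrm{Loc},k-1}(X)\}$. Local flat topology: for $S_n,S\in\mathbf{I}_{\mathrm{Loc},k}(X)$, $S_n$ converges to $S$ in the local flat topology if for every bounded closed $B\subset X$ there exist $U_n\in\mathbf{I}_{\mathrm{Loc},k}(X)$,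 $V_n\in\mathbf{I}_{\mathrm{Loc},k+1}(X)$ with $S_n-S=U_n+\partial V_n$ and $(\|U_n\|+\|V_n\|)(B)\to0$ as $n\to\infty$. Pointed spaces: for $k\ge1$, $\mathcal{M}^k_*$ is the collection of $k$-dimensional pointed locally integral current spaces, i.e. triples $(X,x,T)$ with $X$ a complete separable metric space, $x\in X$ and $T\in\mathbf{I}_{\mathrm{Loc},k}(X)$. Pointed intrinsic flat distance: $d_{\mathcal{F}*}:=\min\{\widetilde{d_{\mathcal{F}*}},\tfrac12\}$, where $\widetilde{d_{\mathcal{F}*}}((X_1,x_1,T_1),(X_2,x_2,T_2))$ is the infimum (with $\inf\emptyset=\infty$) of all $\epsilon>0$ for which there exist a complete metric space $Z$ and isometric embeddings $\phi_i:X_i\hookrightarrow Z$ ($i=1,2$) such that (i) $d_Z(\phi_1(x_1),\phi_2(x_2))<\epsilon$; (ii) for each $i=1,2$ there exist $U_i\in\mathbf{I}_{\mathrm{Loc},k}(Z)$ and $V_i\in\mathbf{I}_{\mathrm{Loc},k+1}(Z)$ with $\phi_{1\#}T_1-\phi_{2\#}T_2=U_i+\partial V_i$ and $(\|U_i\|+\|V_i\|)(\bar B_{1/\epsilon}(\phi_i(x_i)))<\epsilon$. *)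

(* Defs.v *)
From HB Require Import structures.
From mathcomp Require Import all_boot all_order all_algebra.
From mathcomp Require Import all_classical all_reals all_analysis.

Set Implicit Arguments.
Unset Strict Implicit.
Unset Printing Implicit Defensive.

Import Order.TTheory GRing.Theory Num.Theory.
Import numFieldNormedType.Exports.

Local Open Scope classical_set_scope.
Local Open Scope ring_scope.

(* `completeType` is pointed, which here only expresses nonemptiness. *)
#[short(type="completeMetricType")]
HB.structure Definition CompleteMetric (R : numDomainType) :=
  {T of Metric R T & Complete T}.

Section metric_notions.
Context {R : realType}.

Definition separable (X : metricType R) : Prop :=
  exists2 D : set X, countable D & dense D.

Definition isometric_embedding (X Y : metricType R) (phi : X -> Y) : Prop :=
  forall x y, mdist (phi x) (phi y) = mdist x y.

Definition lipschitz_map_on (X Y : metricType R) (A : set X) (phi : X -> Y) :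
    Prop :=
  exists L : R,
    forall x y, A x -> A y -> mdist (phi x) (phi y) <= L * mdist x y.

Context {X : metricType R}.
Implicit Types (A B : set X) (f g : X -> R).

(* Boundedness is finiteness of the diameter, so the empty set is bounded. *)
Definition metric_bounded A : Prop :=
  exists r : R, forall x y, A x -> A y -> mdist x y <= r.

(* The points at distance at most r from A, where the distance to A is an
   infimum (hence +oo if A is empty). For A = [set p] this is the ball
   {x | d(p, x) <= r}, not the closure of the open ball. *)
Definition closed_nbhd (r : R) A : set X :=
  [set x | (ereal_inf [set (mdist a x)%:E | a in A] <= r%:E)%E].

Definition spt f : set X := closure [set x | f x != 0].

Definition lip_on (L : R) A f : Prop :=
  forall x y, A x -> A y -> `|f x - f y| <= L * mdist x y.

Definition Lip_Loc f : Prop :=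
  forall B, metric_bounded B -> exists L, lip_on L B f.

Definition Lip_1 f : Prop := lip_on 1 setT f.

Definition Lip_B f : Prop :=
  [/\ exists M, forall x, `|f x| <= M,
      exists L, lip_on L setT f &
      metric_bounded (spt f)].

End metric_notions.

(* A functional is represented by a total function; only its values on
   D^k(X) = Lip_B(X) x Lip_Loc(X)^k are meaningful, and two functionals are
   identified when they agree there. *)
Definition functional (R : realType) (X : metricType R) (k : nat) : Type :=
  (X -> R) -> ('I_k -> X -> R) -> R.

Section metric_functionals.
Context {R : realType} {X : metricType R}.
Implicit Types (f g p q s : X -> R) (A O : set X).

Definition in_D k f (pi_ : 'I_k -> X -> R) : Prop :=
  Lip_B f /\ forall i, Lip_Loc (pi_ i).

Record metric_functional k (T : functional X k) : Prop := {
  mf_linear_fun : forall (a : R) f g (pi_ : 'I_k -> X -> R),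
    in_D f pi_ -> in_D g pi_ ->
    T (fun x => a * f x + g x) pi_ = a * T f pi_ + T g pi_ ;
  mf_linear_arg : forall (i : 'I_k) (a : R) f (pi_ : 'I_k -> X -> R) p q,
    in_D f pi_ -> Lip_Loc p -> Lip_Loc q ->
    T f [eta pi_ with i |-> (fun x => a * p x + q x)] =
      a * T f [eta pi_ with i |-> p] + T f [eta pi_ with i |-> q] ;
  mf_continuous : forall f (pi_ : 'I_k -> X -> R) (pj : nat -> 'I_k -> X -> R),
    in_D f pi_ -> (forall j, in_D f (pj j)) ->
    (forall i x, pj j i x @[j --> \oo] --> pi_ i x) ->
    (forall i B, metric_bounded B -> exists L, forall j, lip_on L B (pj j i)) ->
    T f (pj j) @[j --> \oo] --> T f pi_ ;
  mf_local : forall f (pi_ : 'I_k -> X -> R),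
    in_D f pi_ ->
    (exists i (delta c : R), 0 < delta /\
       forall x, closed_nbhd delta (spt f) x -> pi_ i x = c) ->
    T f pi_ = 0
}.

Definition push_tuple k f (pi_ : 'I_k -> X -> R) : 'I_k.+1 -> X -> R :=
  fun i => if unlift ord0 i is Some j then pi_ j else f.

(* By locality of T the set below has exactly one element for (f, pi_) in
   D^k(X); the default 0 is never used there. *)
Definition boundary k (T : functional X k.+1) : functional X k :=
  fun f pi_ => xget 0 [set r | exists s, [/\ Lip_B s,
    exists2 delta : R, 0 < delta &
      forall x, closed_nbhd delta (spt f) x -> s x = 1 &
    r = T s (push_tuple f pi_)]].

Definition mass_open k (T : functional X k) O : \bar R :=
  ereal_sup [set r | exists N (f : 'I_N -> X -> R) (pi_ : 'I_N -> 'I_k -> X -> R),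
    [/\ forall j, Lip_B (f j) /\ spt (f j) `<=` O,
        forall j i, Lip_1 (pi_ j i),
        forall x, \sum_(j < N) `|f j x| <= 1 &
        r = (\sum_(j < N) T (f j) (pi_ j))%:E]].

Definition mass k (T : functional X k) A : \bar R :=
  ereal_inf [set mass_open T O | O in [set O | open O /\ A `<=` O]].

(* Membership in M_Loc,k(X), including the tightness condition. *)
Definition locally_finite_mass k (T : functional X k) : Prop :=
  metric_functional T /\
  forall O, open O -> metric_bounded O ->
    (mass T O < +oo)%E /\
    forall e : R, 0 < e ->
      exists K, [/\ compact K, K `<=` O & (mass T (O `\` K) < e%:E)%E].

End metric_functionals.

Definition current_push (R : realType) (X Y : metricType R) (phi : X -> Y) k
    (T : functional X k) : functional Y k :=
  fun f pi_ => T (f \o phi) (fun i => pi_ i \o phi).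

Section euclidean_space.
Context {R : realType}.

Lemma cauchy_schwarz_sum n (a b : 'I_n -> R) :
  (\sum_i a i * b i) ^+ 2 <= (\sum_i a i ^+ 2) * (\sum_i b i ^+ 2).
Proof.
have : 0 <= \sum_i \sum_j (a i * b j - a j * b i) ^+ 2.
  by apply: sumr_ge0 => i _; apply: sumr_ge0 => j _; exact: sqr_ge0.
have -> : \sum_i \sum_j (a i * b j - a j * b i) ^+ 2 =
    ((\sum_i a i ^+ 2) * (\sum_i b i ^+ 2) - (\sum_i a i * b i) ^+ 2) *+ 2.
  transitivity (\sum_i \sum_j (a i ^+ 2 * b j ^+ 2
      - (a i * b i) * (a j * b j) *+ 2 + a j ^+ 2 * b i ^+ 2)).
    apply: eq_bigr => i _; apply: eq_bigr => j _.
    rewrite sqrrB !exprMn; congr (_ - _ *+ 2 + _).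
    by rewrite mulrACA [b j * b i]mulrC [a i * a j * _]mulrACA.
  under eq_bigr do rewrite big_split sumrB /=.
  rewrite big_split sumrB /=.
  have E1 : \sum_i \sum_j a i ^+ 2 * b j ^+ 2 =
      (\sum_i a i ^+ 2) * (\sum_i b i ^+ 2).
    by rewrite mulr_suml; apply: eq_bigr => i _; rewrite mulr_sumr.
  have E2 : \sum_i \sum_j a j ^+ 2 * b i ^+ 2 =
      (\sum_i a i ^+ 2) * (\sum_i b i ^+ 2).
    by rewrite exchange_big E1.
  have E3 : \sum_i \sum_j a i * b i * (a j * b j) *+ 2 =
      (\sum_i a i * b i) ^+ 2 *+ 2.
    rewrite expr2 mulr_suml -sumrMnl; apply: eq_bigr => i _.
    by rewrite mulr_sumr -sumrMnl.
  by rewrite E1 E2 E3 addrAC mulrnBl mulr2n.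
by rewrite pmulrn_lge0// subr_ge0.
Qed.

Lemma minkowski_sum n (a b : 'I_n -> R) :
  Num.sqrt (\sum_i (a i + b i) ^+ 2) <=
  Num.sqrt (\sum_i a i ^+ 2) + Num.sqrt (\sum_i b i ^+ 2).
Proof.
have sq0 (c : 'I_n -> R) : 0 <= \sum_i c i ^+ 2.
  by apply: sumr_ge0 => i _; exact: sqr_ge0.
rewrite -(@ler_pXn2r _ 2)// ?nnegrE ?addr_ge0 ?sqrtr_ge0//.
rewrite sqrrD !sqr_sqrtr//.
under eq_bigr do rewrite sqrrD.
rewrite big_split big_split /= lerD2r lerD2l sumrMnl lerMn2r/=.
rewrite -sqrtrM// (le_trans (ler_norm _))// -sqrtr_sqr ler_wsqrtr//.
exact: cauchy_schwarz_sum.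
Qed.

End euclidean_space.

(* R^k with the Euclidean distance. *)
Definition euclidean (R : realType) (k : nat) : Type := k.-tuple R.

HB.instance Definition _ (R : realType) k :=
  Choice.copy (euclidean R k) (k.-tuple R).

Section euclidean_metric.
Context {R : realType} {k : nat}.
Implicit Types x y z : euclidean R k.

Definition euclidean_dist x y : R :=
  Num.sqrt (\sum_(i < k) (tnth x i - tnth y i) ^+ 2).

Lemma euclidean_distxx x : euclidean_dist x x = 0.
Proof.
by rewrite /euclidean_dist big1 ?sqrtr0// => i _; rewrite subrr expr0n.
Qed.

Lemma euclidean_dist_eq0 x y : euclidean_dist x y = 0 -> x = y.
Proof.
have h0 (i : 'I_k) : true -> 0 <= (tnth x i - tnth y i) ^+ 2.
  by move=> _; exact: sqr_ge0.
move=> /eqP; rewrite sqrtr_eq0 => le0.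
have /eqP : \sum_(i < k) (tnth x i - tnth y i) ^+ 2 = 0.
  by apply/eqP; rewrite eq_le le0 sumr_ge0.
rewrite psumr_eq0// => /allP xy; apply: eq_from_tnth => i.
by have := xy i (mem_index_enum i); rewrite sqrf_eq0 subr_eq0 => /eqP.
Qed.

Lemma euclidean_dist_sym x y : euclidean_dist x y = euclidean_dist y x.
Proof.
rewrite /euclidean_dist; congr Num.sqrt.
by apply: eq_bigr => i _; rewrite -sqrrN opprB.
Qed.

Lemma euclidean_dist_triangle y x z :
  euclidean_dist x z <= euclidean_dist x y + euclidean_dist y z.
Proof.
apply: le_trans (minkowski_sum _ _); rewrite /euclidean_dist ler_wsqrtr//.
by apply: ler_sum => i _; rewrite addrA subrK.
Qed.

HB.instance Definition _ := @isMetric.Build R (euclidean R k) euclidean_dist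
  euclidean_distxx euclidean_dist_eq0 euclidean_dist_sym
  euclidean_dist_triangle.

End euclidean_metric.

(* Lebesgue measure on R^k with its Borel (product) sigma-algebra, by induction
   on k: Dirac mass on the one-point space R^0, and the image of
   lebesgue_measure x lebesgue_euclidean k under (x, t) |-> x :: t on R^k.+1. *)
Section lebesgue_step.
Context {R : realType} {k : nat}.
Local Notation mR := (measurableTypeR R).

Definition tuple_of_pair (p : mR * k.-tuple mR) : k.+1.-tuple mR :=
  [tuple of p.1 :: p.2].

Lemma measurable_tuple_of_pair : measurable_fun setT tuple_of_pair.
Proof. exact: measurable_cons. Qed.

Variable mu : {sigma_finite_measure set (k.-tuple mR) -> \bar R}.

Definition lebesgue_step : set (k.+1.-tuple mR) -> \bar R :=
  pushforward (lebesgue_measure \x mu)%E tuple_of_pair.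

Let step0 : lebesgue_step set0 = 0%E.
Proof. by rewrite /lebesgue_step /pushforward preimage_set0 measure0. Qed.

Let step_ge0 A : (0 <= lebesgue_step A)%E.
Proof.
exact: (measure_ge0 ((lebesgue_measure \x mu)%E : {measure set (mR * k.-tuple mR)%type -> \bar R})).
Qed.

Let step_sigma_additive : semi_sigma_additive lebesgue_step.
Proof.
move=> F mF tF mUF.
pose mup : {measure set (mR * k.-tuple mR)%type -> \bar R} := (lebesgue_measure \x mu)%E.
have mf := measurable_tuple_of_pair.
rewrite /lebesgue_step /pushforward preimage_bigcup.
apply: (@measure_semi_sigma_additive _ _ _ mup).
- by move=> n; rewrite -[X in measurable X]setTI; exact: mf.
- apply/trivIsetP => /= i j _ _ ij; rewrite -preimage_setI.
  by move/trivIsetP : tF => /(_ _ _ _ _ ij) ->//; rewrite preimage_set0.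
- by rewrite -preimage_bigcup -[X in measurable X]setTI; exact: mf.
Qed.

HB.instance Definition _ := isMeasure.Build _ _ _ lebesgue_step
  step0 step_ge0 step_sigma_additive.

Let step_sigma_finite : sigma_finite setT lebesgue_step.
Proof.
have /sigma_finiteP[F [TF _ Foo]] :
    sigma_finite setT (lebesgue_measure \x mu)%E.
  have /sigma_finiteP[F [TF ndF Foo]] :=
    sigma_finiteT (lebesgue_measure : {sigma_finite_measure set mR -> \bar R}).
  have /sigma_finiteP[G [TG ndG Goo]] := sigma_finiteT mu.
  exists (fun n => F n `*` G n).
    rewrite -setXTT TF TG predeqE => -[x y]; split.
      move=> [/= [n _ Fnx] [i _ Giy]]; exists (maxn n i) => //; split.
      - by move: x Fnx; exact/subsetPset/ndF/leq_maxl.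
      - by move: y Giy; exact/subsetPset/ndG/leq_maxr.
    by move=> [n _ []/= ? ?]; split; exists n.
  move=> i; have [? ?] := Foo i; have [? ?] := Goo i.
  split; first exact: measurableX.
  by rewrite product_measure1E// lte_mul_pinfty// ge0_fin_numE.
pose g (t : k.+1.-tuple mR) : mR * k.-tuple mR := (thead t, [tuple of behead t]).
have mg : measurable_fun setT g.
  apply/measurable_fun_pairP; split.
    exact: (measurable_tnth ord0).
  exact: measurable_behead.
exists (fun n => g @^-1` F n).
  by rewrite -preimage_bigcup -TF preimage_setT.
move=> n; have [mF Fn] := Foo n; split.
  by rewrite -[X in measurable X]setTI; exact: mg.
rewrite /lebesgue_step /pushforward -comp_preimage.
rewrite (_ : g \o tuple_of_pair = id)// ?preimage_id//.
apply/funext => -[x t]; rewrite /g /tuple_of_pair/= theadE.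
by congr pair; exact/val_inj.
Qed.

HB.instance Definition _ := Measure_isSigmaFinite.Build _ _ _ lebesgue_step
  step_sigma_finite.

End lebesgue_step.

Fixpoint lebesgue_euclidean (R : realType) (k : nat) :
    {sigma_finite_measure set (k.-tuple (measurableTypeR R)) -> \bar R} :=
  match k with
  | 0 => dirac [tuple]
  | k'.+1 => lebesgue_step (lebesgue_euclidean R k')
  end.

Section current_of_function.
Context {R : realType} {k : nat}.

Definition set_coord (x : euclidean R k) (j : 'I_k) (t : R) : euclidean R k :=
  [tuple if i == j then t else tnth x i | i < k].

(* Entries are 0 where a partial derivative does not exist; for components that
   are Lipschitz on bounded sets this is a null set. *)
Definition gradient_matrix (tau : 'I_k -> euclidean R k -> R)
    (x : euclidean R k) : 'M[R]_k :=
  \matrix_(i, j) derive1 (fun t : R => tau i (set_coord x j t) : R) (tnth x j).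

Definition current_of_function (theta : euclidean R k -> int) :
    functional (euclidean R k) k :=
  fun f tau => fine (\int[lebesgue_euclidean R k]_x
    (f x * (theta x)%:~R * \det (gradient_matrix tau x))%:E)%E.

(* theta is taken Borel; every Lebesgue class has a Borel representative. *)
Definition integrable_int (theta : euclidean R k -> int) : Prop :=
  (lebesgue_euclidean R k).-integrable setT
    (fun x : k.-tuple (measurableTypeR R) => ((theta x)%:~R : R)%:E).

End current_of_function.

Notation borel X := (g_sigma_algebraType (@open X)).

Section currents.
Context {R : realType} {X : completeMetricType R}.
Implicit Types (f : X -> R) (A B K : set X).

(* T(f, pi) for f bounded Borel of bounded support: the set below has exactly
   one element when T has locally finite mass and every pi_ i is in Lip_Loc. *)
Definition extension k (T : functional X k) : functional X k :=
  fun f pi_ => xget 0 [set l | exists (W : set X) (fn : nat -> X -> R),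
    [/\ metric_bounded W /\ spt f `<=` interior W,
        forall n, Lip_B (fn n) /\ spt (fn n) `<=` W,
        (\int[mass T : set (borel X) -> \bar R]_x `|fn n x - f x|%:E)%E
          @[n --> \oo] --> 0%E &
        T (fn n) pi_ @[n --> \oo] --> l]].

Definition restriction k (T : functional X k) A : functional X k :=
  fun f pi_ => extension T (fun x => f x * \1_A x) pi_.

(* g i matters only on C i; outside it its values are arbitrary. *)
Definition compact_rectifiable (k : nat) K : Prop :=
  exists N (C : 'I_N -> set (euclidean R k)) (g : 'I_N -> euclidean R k -> X),
    [/\ forall i, compact (C i),
        forall i, lipschitz_map_on (C i) (g i) &
        K = \bigcup_(i in [set: 'I_N]) (g i @` C i)].

Definition loc_int_rectifiable k (T : functional X k) : Prop :=
  [/\ locally_finite_mass T,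
      forall O, open O -> metric_bounded O -> forall e : R, 0 < e ->
        exists K, compact_rectifiable k K /\ (mass T (O `\` K) < e%:E)%E &
      forall B, (measurable : set (set (borel X))) B -> metric_bounded B ->
        forall p : X -> euclidean R k, lipschitz_map_on setT p ->
        exists2 theta : euclidean R k -> int, integrable_int theta &
          forall (h : euclidean R k -> R) (tau : 'I_k -> euclidean R k -> R),
            in_D h tau ->
            current_push p (restriction T B) h tau =
            current_of_function theta h tau].

(* The usual notion is for k >= 1; for k = 0 there is no boundary to constrain. *)
Definition loc_integral {k} : functional X k -> Prop :=
  match k return functional X k -> Prop with
  | 0 => fun T => loc_int_rectifiable T
  | k'.+1 => fun T => loc_int_rectifiable T /\ loc_int_rectifiable (boundary T)
  end.

(* S1 - S2 = U + boundary V as functionals on D^k(X) *)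
Definition flat_decomposition k (S1 S2 U : functional X k)
    (V : functional X k.+1) : Prop :=
  forall f pi_, in_D f pi_ ->
    S1 f pi_ - S2 f pi_ = U f pi_ + boundary V f pi_.

(* Meant for S_ n and S in I_Loc,k(X); this membership is not required here. *)
Definition local_flat_cvg k (S_ : nat -> functional X k) (S : functional X k) :
    Prop :=
  forall B, closed B -> metric_bounded B ->
    exists (U : nat -> functional X k) (V : nat -> functional X k.+1),
    [/\ forall n, loc_integral (U n),
        forall n, loc_integral (V n),
        forall n, flat_decomposition (S_ n) S (U n) (V n) &
        (mass (U n) B + mass (V n) B)%E @[n --> \oo] --> 0%E].

End currents.

Record pointed_current_space (R : realType) (k : nat) := PointedCurrentSpace {
  pcs_space :> completeMetricType R ;
  pcs_separable : separable pcs_space ;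
  pcs_point : pcs_space ;
  pcs_current : functional pcs_space k ;
  pcs_integral : loc_integral pcs_current
}.

Arguments pcs_point {R k} p.
Arguments pcs_current {R k} p _ _.

Section pointed_flat_distance.
Context {R : realType} {k : nat}.
Implicit Types X : pointed_current_space R k.

Definition flat_close X1 X2 (e : R) : Prop :=
  exists (Z : completeMetricType R) (phi1 : X1 -> Z) (phi2 : X2 -> Z),
    [/\ isometric_embedding phi1, isometric_embedding phi2,
        mdist (phi1 (pcs_point X1)) (phi2 (pcs_point X2)) < e &
        forall p, p = phi1 (pcs_point X1) \/ p = phi2 (pcs_point X2) ->
        exists (U : functional Z k) (V : functional Z k.+1),
        [/\ loc_integral U, loc_integral V,
            flat_decomposition (current_push phi1 (pcs_current X1))
              (current_push phi2 (pcs_current X2)) U V &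
            (mass U (closed_nbhd e^-1 [set p])
               + mass V (closed_nbhd e^-1 [set p]) < e%:E)%E]].

Definition pointed_flat_pre X1 X2 : \bar R :=
  ereal_inf [set e%:E | e in [set e : R | 0 < e /\ flat_close X1 X2 e]].

(* The minimum lies in [0, 1/2], so `fine` loses nothing. *)
Definition pointed_flat_dist X1 X2 : R :=
  fine (Order.min (pointed_flat_pre X1 X2) (2^-1)%:E).

End pointed_flat_distance.

(* Main.v *)
Require Import Defs.
From mathcomp Require Import all_boot all_order all_algebra.
From mathcomp Require Import all_classical all_reals all_analysis.
Import Order.TTheory GRing.Theory Num.Theory.
Import numFieldNormedType.Exports.
Local Open Scope classical_set_scope.
Local Open Scope ring_scope.

(** The limit space [Z] itself can serve as the common ambient space: embed
    [X n] by [phi n] and [Z] by the identity. Given [e > 0], the two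
    base points [phi n x_n] and [z] are eventually less than [e] apart, so the
    closed balls of radius [1/e] around either of them lie in the single closed
    bounded ball of radius [1/e + e] around [z], which does not depend on [n]
    ([closed_nbhd_set1_subset]). Local flat convergence on this ball yields one
    decomposition [U_n + boundary V_n] of the difference of the currents whose
    total mass there tends to 0; as mass is monotone ([le_mass]), it is below
    [e] on both smaller balls. Hence [e] is admissible in the infimum defining
    the distance for all large [n] ([pointed_flat_dist_le]). *)

Section closed_balls.
Context {R : realType} {X : metricType R}.
Implicit Types (p q x : X) (r s : R).

Lemma closed_nbhd_set1 r p : closed_nbhd r [set p] = [set x | mdist p x <= r].
Proof.
by apply/seteqP; split=> x; rewrite /closed_nbhd/= image_set1 ereal_inf1 lee_fin.
Qed.

Lemma closed_nbhd_set1_subset r s p q :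
  mdist q p + r <= s -> closed_nbhd r [set p] `<=` closed_nbhd s [set q].
Proof.
move=> qps x; rewrite !closed_nbhd_set1/= => pxr.
by rewrite (le_trans (metric_triangle q p x))// (le_trans _ qps)// lerD2l.
Qed.

Lemma closed_nbhd_set1_closed r p : closed (closed_nbhd r [set p]).
Proof.
(* Otherwise the gap mdist p x - r would be the radius of a ball around the
   limit point x that misses the set. *)
rewrite closed_nbhd_set1 => x clx; rewrite /= leNgt; apply/negP => rpx.
have gap0 : 0 < mdist p x - r by rewrite subr_gt0.
have [y /= [pyr]] := clx _ (nbhsx_ballx x (mdist p x - r) gap0).
rewrite ballEmdist/= ltNge => /negP; apply.
by rewrite lerBlDl (le_trans (metric_triangle p y x))// [mdist y x]metric_sym lerD2r.
Qed.

Lemma closed_nbhd_set1_bounded r p : metric_bounded (closed_nbhd r [set p]).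
Proof.
exists (r + r) => x y; rewrite closed_nbhd_set1/= => px py.
by rewrite (le_trans (metric_triangle x p y))// [mdist x p]metric_sym lerD.
Qed.

End closed_balls.

Lemma le_mass (R : realType) (X : metricType R) (k : nat)
    (T : functional X k) (A B : set X) :
  A `<=` B -> (mass T A <= mass T B)%E.
Proof.
move=> AB; apply: ereal_inf_le_tmp => _ [W [oW BW] <-]; exists W => //.
by split => //; exact: subset_trans BW.
Qed.

Section pointed_flat_dist_bounds.
Context {R : realType} {k : nat}.
Implicit Types X : pointed_current_space R k.

Lemma pointed_flat_pre_ge0 X1 X2 : (0 <= pointed_flat_pre X1 X2)%E.
Proof.
by apply: le_ereal_inf_tmp => _ [e [e0 _] <-]; rewrite lee_fin ltW.
Qed.

Lemma pointed_flat_min_ge0 X1 X2 :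
  (0 <= Order.min (pointed_flat_pre X1 X2) (2^-1)%:E)%E.
Proof. by rewrite le_min pointed_flat_pre_ge0 lee_fin invr_ge0 ler0n. Qed.

Lemma pointed_flat_dist_ge0 X1 X2 : 0 <= pointed_flat_dist X1 X2.
Proof. exact/fine_ge0/pointed_flat_min_ge0. Qed.

Lemma pointed_flat_dist_le X1 X2 (e : R) :
  0 < e -> flat_close X1 X2 e -> pointed_flat_dist X1 X2 <= e.
Proof.
move=> e0 close; rewrite -lee_fin /pointed_flat_dist fineK.
  by rewrite ge_min; apply/orP; left; apply: ereal_inf_lbound; exists e.
rewrite ge0_fin_numE ?pointed_flat_min_ge0//.
by rewrite gt_min ltry orbT.
Qed.

End pointed_flat_dist_bounds.

(** One decomposition suffices for both base points: a ball around [z] of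
    radius [1/e + e] swallows the balls of radius [1/e] around each of them. *)
Lemma flat_close_push (R : realType) (k : nat) (X Z : pointed_current_space R k)
    (phi : X -> Z) (e : R) (U : functional Z k) (V : functional Z k.+1) :
  isometric_embedding phi -> mdist (pcs_point Z) (phi (pcs_point X)) < e ->
  loc_integral U -> loc_integral V ->
  flat_decomposition (current_push phi (pcs_current X)) (pcs_current Z) U V ->
  (mass U (closed_nbhd (e^-1 + e) [set pcs_point Z])
    + mass V (closed_nbhd (e^-1 + e) [set pcs_point Z]) < e%:E)%E ->
  flat_close X Z e.
Proof.
move=> iphi ze iU iV dec small; exists Z, phi, id; split => //.
  by rewrite metric_sym.
move=> p pE; exists U, V; split => //.
have ball_sub : closed_nbhd e^-1 [set p] `<=`
    closed_nbhd (e^-1 + e) [set pcs_point Z].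
  apply: closed_nbhd_set1_subset; rewrite addrC lerD2l.
  case: pE => ->; first exact: ltW.
  by rewrite mdistxx (le_trans (mdist_ge0 _ _) (ltW ze)).
by apply: le_lt_trans small; apply: leeD; exact: le_mass.
Qed.

Theorem proposition3p4 (R : realType) (k : nat) (hk : (1 <= k)%N)
    (X : nat -> pointed_current_space R k) (Z : pointed_current_space R k)
    (phi : forall n : nat, X n -> Z)
    (hphi : forall n : nat, isometric_embedding (phi n))
    (hpoint : phi n (pcs_point (X n)) @[n --> \oo] --> pcs_point Z)
    (hflat : local_flat_cvg
       (fun n : nat => current_push (phi n) (pcs_current (X n)))
       (pcs_current Z)) :
  pointed_flat_dist (X n) Z @[n --> \oo] --> (0 : R).
Proof.
apply/cvgr0Pnorm_le => e e0.
have [U [V [iU iV dec cvg0]]] := hflat _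
  (closed_nbhd_set1_closed (e^-1 + e) (pcs_point Z))
  (closed_nbhd_set1_bounded (e^-1 + e) (pcs_point Z)).
have small : \forall n \near \oo,
    (mass (U n) (closed_nbhd (e^-1 + e) [set pcs_point Z])
     + mass (V n) (closed_nbhd (e^-1 + e) [set pcs_point Z]) < e%:E)%E.
  apply: (cvg0 [set x | (x < e%:E)%E]).
  by apply: open_nbhs_nbhs; split; [exact: open_ereal_lt_ereal|rewrite /= lte_fin].
near=> n.
rewrite ger0_norm ?pointed_flat_dist_ge0//; apply: pointed_flat_dist_le => //.
apply: (@flat_close_push _ _ _ _ (phi n) e (U n) (V n)) => //.
- by near: n; exact: metricType_numDomainType.cvgr_dist_lt.
- by near: n.
Unshelve. all: by end_near.
Qed.
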